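(* Let $\mathbf{U}=(U_1,\dots,U_d)\in\mathrm{U}(n)^d$ be a tuple of unitary matrices. There exists some $s_0>0$ such that for all $s\in(0,s_0)$, the unitary matrix tuple $\mathbf{U}^s=(U_1^s,\dots,U_d^s)\in\mathrm{U}(n)^d$ satisfies $\mu(\mathbf{U}^s)\ge\mu(\mathbf{U})/d$.
   Context: $\mathrm{U}(n)$ is the group of $n\times n$ complex unitary matrices, $n\ge2$. Powers: for each unitary matrix $U$ a Hermitian matrix $H$ with $U=e^{\mathrm{i}H}$ is fixed (an arbitrary choice, made once), and for real $s>0$ one defines $U^s=e^{\mathrm{i}sH}$. Dimension expansion: for a tuple $\mathbf{B}=(B_1,\dots,B_d)$ of $n\times n$ complex matrices and $V\le\mathbb{C}^n$, let $\mathbf{B}(V)$ be the linear span of $\bigcup_iB_i(V)$; then $$\mu(\mathbf{B})=\min_{V\le\mathbb{C}^n,\ 1\le\dim V\le n/2}\frac{\dim(V+\mathbf{B}(V))-\dim V}{\dim V}.$$ *)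

(* Defs.v *)
From mathcomp Require Import all_boot all_order all_algebra.
From mathcomp Require Import complex.
From mathcomp Require Import all_classical all_reals all_analysis.

Set Implicit Arguments.
Unset Strict Implicit.
Unset Printing Implicit Defensive.

Import Order.TTheory GRing.Theory Num.Theory.
Import numFieldNormedType.Exports.

Local Open Scope classical_set_scope.
Local Open Scope ring_scope.
Local Open Scope complex_scope.

(* The limit is taken in the normed space of matrices over the normed field
   R[i], i.e. for the usual (entrywise) topology. *)
Definition expmx (R : realType) (n : nat) (A : 'M[R[i]]_n) : 'M[R[i]]_n :=
  lim (series (fun k : nat => (k`!%:R)^-1 *: A ^+ k) @ \oo).

(* A choice, for every unitary U, of a Hermitian H with U = e^{iH}; its values
   at non-unitary matrices are irrelevant. *)
Definition hermitian_log (R : realType) (n : nat)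
    (logU : 'M[R[i]]_n -> 'M[R[i]]_n) : Prop :=
  forall U : 'M[R[i]]_n, U \is unitarymx ->
    logU U \is hermsymmx /\ U = expmx ('i *: logU U).

Definition unitary_power (R : realType) (n : nat)
    (logU : 'M[R[i]]_n -> 'M[R[i]]_n) (U : 'M[R[i]]_n) (s : R) : 'M[R[i]]_n :=
  expmx (('i * s%:C) *: logU U).

Section DimensionExpansion.
Variables (R : realType) (n d : nat) (B : 'I_d -> 'M[R[i]]_n).
Implicit Types V : {vspace 'cV[R[i]]_n}.

Definition tuple_image V : {vspace 'cV[R[i]]_n} :=
  (\sum_(i < d) (linfun (mulmx (B i)) @: V))%VS.

Definition expansion_ratio V : R :=
  ((\dim (V + tuple_image V))%:R - (\dim V)%:R) / (\dim V)%:R.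

Definition small_subspace V : Prop :=
  (1 <= \dim V)%N /\ (\dim V)%:R <= n%:R / 2 :> R.

(* Written as an infimum; it is a minimum for n >= 2, see mu_attained and
   mu_le below. *)
Definition mu : R := inf [set expansion_ratio V | V in small_subspace].

Lemma expansion_ratio_ge0 V : 0 <= expansion_ratio V.
Proof.
rewrite /expansion_ratio divr_ge0// subr_ge0 ler_nat.
by apply: dimvS; exact: addvSl.
Qed.

Lemma mu_le V : small_subspace V -> mu <= expansion_ratio V.
Proof.
move=> sV; apply: ge_inf; last by exists V.
by exists 0 => _ [W _ <-]; exact: expansion_ratio_ge0.
Qed.

Lemma mu_attained : (2 <= n)%N ->
  exists2 V, small_subspace V & mu = expansion_ratio V.
Proof.
move=> n2.
have dimn (W : {vspace 'cV[R[i]]_n}) : (\dim W <= n)%N.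
  by have := dimvS (subvf W); rewrite dimvf dim_matrix [X in (_ <= X)%N]muln1.
have [V0 sV0] : exists V, small_subspace V.
  exists <[const_mx 1]>%VS.
  have nz : (const_mx 1 : 'cV[R[i]]_n) != 0.
    apply/eqP => /matrixP /(_ (Ordinal (ltnW n2)) 0); rewrite !mxE => /eqP.
    by rewrite oner_eq0.
  rewrite /small_subspace dim_vline nz; split => //.
  by rewrite ler_pdivlMr ?ltr0n// mul1r ler_nat.
pose val (p : 'I_n.+1 * 'I_n.+1) : R := ((p.1)%:R - (p.2)%:R) / (p.2)%:R.
pose code W := (inord (\dim (W + tuple_image W)), inord (\dim W)) : 'I_n.+1 * 'I_n.+1.
have valE W : val (code W) = expansion_ratio W.
  by rewrite /val /code /= !inordK// ltnS.
pose good p := `[< exists2 W, small_subspace W & code W = p >].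
have good0 : good (code V0) by apply/asboolP; exists V0.
case: (arg_minP val good0) => p /asboolP[V sV cV] pmin.
exists V => //; apply/eqP; rewrite eq_le mu_le//=.
apply: lb_le_inf; first by exists (expansion_ratio V0), V0.
move=> _ [W sW <-]; rewrite -!valE cV; apply: pmin.
by apply/asboolP; exists W.
Qed.

End DimensionExpansion.

(* Main.v *)
(* If mu(U^s) is attained at V, with dim V = k and dim (V + U^s(V)) = w, then
   U^s lies in the set Z of matrix tuples B for which there are subspaces
   V <= W of dimensions k and w with every B_j(V) inside W.  By quantifier
   elimination over the algebraically closed field R[i], membership in Z is a
   Boolean combination of polynomial equations in the entries of B, and the
   entries of U^s are exponential sums in s.  An exponential sum that is not
   identically zero has isolated zeros, so there is one truth value that
   membership of U^s in Z takes on a punctured neighbourhood of every s.  If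
   U^s is in Z for arbitrarily small s > 0, it is therefore in Z for s close to
   1, and U = U^1 is in Z because Z is closed: the subspaces may be encoded by
   orthogonal projections, which live in a compact set.  Hence
   mu(U) <= (w - k) / k = mu(U^s). *)
Require Import Defs.
From mathcomp Require Import all_boot all_order all_algebra all_field.
From mathcomp Require Import complex.
From mathcomp Require Import all_classical all_reals all_analysis.
From mathcomp Require Import ring lra.

Set Implicit Arguments.
Unset Strict Implicit.
Unset Printing Implicit Defensive.

Import Order.TTheory GRing.Theory Num.Theory.
Import numFieldNormedType.Exports.

Local Open Scope classical_set_scope.
Local Open Scope ring_scope.
Local Open Scope complex_scope.

(* The topology on the complex numbers is found through their numFieldType
   structure only, hence this cast in types where continuity matters. *)
Notation cnum R := (R[i] : numFieldType).

(** * Polynomial functions and elimination of unknowns *)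

Section PolynomialFunctions.
Variables (F : fieldType) (T : Type) (co : T -> seq F).

(** Polynomials are kept as ring terms, the form in which quantifier elimination takes them; [rterm]
    rules out inverses. *)
Definition polyfun (f : T -> F) : Prop :=
  exists2 t : GRing.term F, GRing.rterm t & forall x, f x = GRing.eval (co x) t.

Lemma polyfun_const c : polyfun (fun=> c).
Proof. by exists (GRing.Const c). Qed.

Lemma polyfun_coord k : polyfun (fun x => (co x)`_k).
Proof. by exists (GRing.Var _ k). Qed.

Lemma polyfunD f g : polyfun f -> polyfun g -> polyfun (fun x => f x + g x).
Proof.
move=> [t rt ft] [u ru gu]; exists (GRing.Add t u) => [|x] /=.
  by rewrite rt ru.
by rewrite ft gu.
Qed.

Lemma polyfunN f : polyfun f -> polyfun (fun x => - f x).
Proof. by move=> [t rt ft]; exists (GRing.Opp t) => //= x; rewrite ft. Qed.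

Lemma polyfunM f g : polyfun f -> polyfun g -> polyfun (fun x => f x * g x).
Proof.
move=> [t rt ft] [u ru gu]; exists (GRing.Mul t u) => [|x] /=.
  by rewrite rt ru.
by rewrite ft gu.
Qed.

Lemma polyfun_sum (I : finType) (f : I -> T -> F) :
  (forall i, polyfun (f i)) -> polyfun (fun x => \sum_i f i x).
Proof.
move=> pf; elim: (index_enum I) => [|i s IHs].
  by exists (GRing.Const 0) => // x; rewrite big_nil.
have [t rt ft] := polyfunD (pf i) IHs.
by exists t => // x; rewrite big_cons ft.
Qed.

Lemma eq_polyfun f g : f =1 g -> polyfun f -> polyfun g.
Proof. by move=> fg [t rt ft]; exists t => // x; rewrite -fg. Qed.

Definition polymx m n (A : T -> 'M[F]_(m, n)) :=
  forall i j, polyfun (fun x => A x i j).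

Lemma polymxB m n (A B : T -> 'M[F]_(m, n)) :
  polymx A -> polymx B -> polymx (fun x => A x - B x).
Proof.
move=> pA pB i j; apply: eq_polyfun (polyfunD (pA i j) (polyfunN (pB i j))) => x.
by rewrite !mxE.
Qed.

Lemma polymxM m n p (A : T -> 'M[F]_(m, n)) (B : T -> 'M[F]_(n, p)) :
  polymx A -> polymx B -> polymx (fun x => A x *m B x).
Proof.
move=> pA pB i j.
apply: eq_polyfun (polyfun_sum (fun k => polyfunM (pA i k) (pB k j))) => x.
by rewrite mxE.
Qed.

Lemma polymx_tr m n (A : T -> 'M[F]_(m, n)) :
  polymx A -> polymx (fun x => (A x)^T).
Proof. by move=> pA i j; apply: eq_polyfun (pA j i) => x; rewrite mxE. Qed.

Lemma polyfun_mxtrace n (A : T -> 'M[F]_n) :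
  polymx A -> polyfun (fun x => \tr (A x)).
Proof. by move=> pA; apply: polyfun_sum => i; exact: pA. Qed.

End PolynomialFunctions.

Section RowSequences.
Variable F : fieldType.

Definition row_seq n (x : 'rV[F]_n) : seq F := [seq x 0 i | i : 'I_n].

Lemma size_row_seq n (x : 'rV[F]_n) : size (row_seq x) = n.
Proof. by rewrite size_map size_enum_ord. Qed.

Lemma nth_row_seq n (x : 'rV[F]_n) (i : 'I_n) : (row_seq x)`_i = x 0 i.
Proof. by rewrite (nth_map i) ?size_enum_ord// nth_ord_enum. Qed.

(** As an environment, this puts the parameters in variables [0] to [m - 1] and the unknowns in
    variables [m] to [m + n - 1]; later variables read the default [0]. *)
Definition pair_seq m n (z : 'rV[F]_m * 'rV[F]_n) : seq F :=
  row_seq z.1 ++ row_seq z.2.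

Lemma polyfun_fst m n (i : 'I_m) : polyfun (@pair_seq m n) (fun z => z.1 0 i).
Proof.
apply: eq_polyfun (polyfun_coord _ i) => z.
by rewrite nth_cat size_row_seq ltn_ord nth_row_seq.
Qed.

Lemma polyfun_snd m n (j : 'I_n) : polyfun (@pair_seq m n) (fun z => z.2 0 j).
Proof.
apply: eq_polyfun (polyfun_coord _ (m + j)) => z.
by rewrite nth_cat size_row_seq ltnNge leq_addr/= addKn nth_row_seq.
Qed.

End RowSequences.

(** The equations form one conjunction [h]; quantifying it existentially over the unknowns and
    eliminating the quantifiers over the algebraically closed field gives [g]. *)
Lemma zero_locus_projection (F : closedFieldType) m n (I : finType)
    (f : I -> 'rV[F]_m * 'rV[F]_n -> F) :
  (forall i, polyfun (@pair_seq F m n) (f i)) ->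
  exists2 g : GRing.formula F, GRing.qf_form g && GRing.rformula g &
    forall x, (exists y, forall i, f i (x, y) = 0) <->
              GRing.qf_eval (row_seq x) g.
Proof.
move=> /fin_all_exists2[t rt ft].
pose h := foldr GRing.And (GRing.Bool true)
  [seq GRing.Equal (t i) (GRing.Const 0) | i <- enum I].
have hP e : GRing.holds e h <-> forall i, GRing.eval e (t i) = 0.
  suff H s : GRing.holds e (foldr GRing.And (GRing.Bool true)
      [seq GRing.Equal (t i) (GRing.Const 0) | i <- s]) <->
      (forall i, i \in s -> GRing.eval e (t i) = 0).
    split=> [/H H' i|H']; first by apply: H'; rewrite mem_enum.
    by apply/H => i _; exact: H'.
  elim: s => [|i s IHs] //=; split=> [[ti /IHs ts] j|ts].
    by rewrite in_cons => /predU1P[->//|]; exact: ts.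
  split; first by apply: ts; rewrite mem_head.
  by apply/IHs => j js; apply: ts; rewrite in_cons js orbT.
pose f' := foldr GRing.Exists h (iota m n).
have rf' : GRing.rformula f'.
  have -> : GRing.rformula f' = GRing.rformula h.
    by rewrite /f'; elim: (iota m n).
  by rewrite /h; elim: (enum I) => //= i s ->; rewrite rt.
have clF := @solve_monicpoly F.
exists (GRing.quantifier_elim (@ClosedFieldQE.ex_elim F) f').
  exact/(GRing.quantifier_elim_wf (@ClosedFieldQE.wf_ex_elim F)).
move=> x; have qeP := GRing.quantifier_elim_rformP
  (@ClosedFieldQE.wf_ex_elim F) (ClosedFieldQE.holds_ex_elim clF)
  (row_seq x) rf'.
suff H : (exists y, forall i, f i (x, y) = 0) <-> GRing.holds (row_seq x) f'.
  by split=> [/H/qeP|/qeP/H].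
split=> [[y fxy]|/GRing.foldExistsP[e eE /hP he]].
  apply/GRing.foldExistsP; exists (pair_seq (x, y)).
    move=> k; rewrite nth_cat size_row_seq inE /= mem_iota.
    case: (ltnP k m) => [//|mk]; rewrite /= -leqNgt => mnk.
    by rewrite !nth_default// size_row_seq// leq_subRL.
  by apply/hP => i; rewrite -ft.
(* [e] agrees with [row_seq x] except possibly on the quantified variables, so its entries there are
   the solution; beyond them both read [0]. *)
exists (\row_j e`_(m + j)) => i; rewrite ft -[RHS](he i).
apply: GRing.eq_eval => k; rewrite nth_cat size_row_seq.
case: ltnP => km.
  by rewrite eE// inE /= mem_iota leqNgt km.
have [kmn|kmn] := ltnP (k - m) n.
  by rewrite (nth_row_seq _ (Ordinal kmn)) mxE/= subnKC.
rewrite nth_default ?size_row_seq// -eE; last first.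
  by rewrite inE /= mem_iota km/= -leqNgt -leq_subRL.
by rewrite nth_default// size_row_seq.
Qed.

(** * The complex exponential on the imaginary axis *)

Section ComplexExponential.
Variable R : realType.

Lemma continuous_real_complex : continuous (real_complex R : R -> cnum R).
Proof.
(* A positive element of [R[i]] is real with positive real part, so the estimate is one between real
   numbers. *)
move=> x; apply/cvgrPdist_lt => e; rewrite ltcE/= => /andP[/eqP Ime Ree].
near=> y.
rewrite -raddfB/= normc_def/= expr0n addr0 sqrtr_sqr ltcE/= Ime eqxx/=.
by near: y; exact: cvgr_dist_lt.
Unshelve. all: by end_near. Qed.

Definition cis (x : R) : cnum R := cos x +i* sin x.

Lemma cisE x : cis x = (cos x)%:C + 'i * (sin x)%:C.
Proof. exact: complexE. Qed.

Lemma cisD x y : cis (x + y) = cis x * cis y.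
Proof. by apply/eqP; rewrite eq_complex/= cosD sinD addrC eqxx/= addrC. Qed.

Lemma cis0 : cis 0 = 1.
Proof. by rewrite /cis cos0 sin0. Qed.

Lemma cisMconj x : cis x * (cis x)^* = 1.
Proof.
apply/eqP; rewrite eq_complex/= !mulrN opprK -!expr2 cos2Dsin2 eqxx/=.
by rewrite addrC mulrC subrr.
Qed.

Lemma continuous_cis : continuous cis.
Proof.
move=> x; rewrite (_ : cis = fun x => (cos x)%:C + 'i * (sin x)%:C).
  apply: cvgD.
    apply: continuous_comp; [exact: continuous_cos|].
    exact: continuous_real_complex.
  apply: cvgMl_tmp; apply: continuous_comp; [exact: continuous_sin|].
  exact: continuous_real_complex.
by apply/funext => y; exact: cisE.
Qed.

Lemma exp_term_cis (x : R) n : ('i * x%:C) ^+ n / n`!%:R =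
  (cos_coeff x n)%:C + 'i * (sin_coeff x n)%:C.
Proof.
have sqri : 'i ^+ 2 = -1 :> R[i] by rewrite sqr_i.
rewrite /cos_coeff /sin_coeff /=.
have -> : n`!%:R = (n`!%:R)%:C :> R[i] by rewrite rmorph_nat.
rewrite !rmorphM/= !fmorphV !mulrA -mulrDl; congr (_ / _).
rewrite exprMn !rmorphXn/= -mulrDl; congr (_ * _).
rewrite !rmorph_nat rmorphN1.
(* Writing [n] as its parity plus twice its half turns ['i ^+ n] into ['i ^+ odd n] times a power of
   [-1]; the parity decides between cosine and sine. *)
rewrite -[in LHS](odd_double_half n) exprD -mul2n exprM sqri.
case: (boolP (odd n)) => on /=.
  rewrite expr1 mul0r add0r mulr1; congr (_ * _).
  by rewrite -[in RHS](odd_double_half n) on /= doubleK.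
by rewrite mulr0 mul0r addr0.
Qed.

Lemma cvg_series_cis (x : R) :
  series (fun n => ('i * x%:C) ^+ n / n`!%:R) @ \oo --> cis x.
Proof.
rewrite (_ : series _ = fun n => (series (cos_coeff x) n)%:C +
    'i * (series (sin_coeff x) n)%:C); last first.
  apply/funext => n; rewrite /series/= !rmorph_sum mulr_sumr -big_split/=.
  by apply: eq_bigr => k _; exact: exp_term_cis.
rewrite cisE; apply: cvgD.
  apply: (@continuous_cvg _ _ _ _ _ _ (real_complex R : R -> cnum R)).
    exact: continuous_real_complex.
  by rewrite unlock; exact: is_cvg_series_cos_coeff.
apply: cvgMl_tmp.
apply: (@continuous_cvg _ _ _ _ _ _ (real_complex R : R -> cnum R)).
  exact: continuous_real_complex.
by rewrite unlock; exact: is_cvg_series_sin_coeff.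
Qed.

End ComplexExponential.

(** * Zeros of exponential sums *)

Section ExponentialSums.
Variable R : realType.
Implicit Type l : seq (R[i] * R).

(** A pair holds a coefficient and a real frequency. Frequencies may repeat, as vanishing is tested
    through derivatives rather than coefficients. *)
Definition expsum l (s : R) : cnum R := \sum_(p <- l) p.1 * cis (p.2 * s).

(** Differentiation is done on the list, so that all derivatives are again exponential sums. *)
Definition expsum_deriv l : seq (R[i] * R) :=
  [seq (p.1 * ('i * p.2%:C), p.2) | p <- l].

Lemma expsum_cons p l s : expsum (p :: l) s = p.1 * cis (p.2 * s) + expsum l s.
Proof. by rewrite /expsum big_cons. Qed.

Lemma expsum_nil s : expsum [::] s = 0.
Proof. by rewrite /expsum big_nil. Qed.

Lemma Re_expsum_cons p l s : complex.Re (expsum (p :: l) s) =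
  complex.Re p.1 * cos (p.2 * s) - complex.Im p.1 * sin (p.2 * s)
  + complex.Re (expsum l s).
Proof. by rewrite expsum_cons; case: p => -[a b] c /=; case: (expsum l s). Qed.

(** The real part is singled out because Rolle's theorem concerns real-valued functions. *)
Lemma is_derive_Re_expsum l (t : R) :
  is_derive t 1 (fun s => complex.Re (expsum l s))
    (complex.Re (expsum (expsum_deriv l) t)).
Proof.
elim: l => [|p l IHl].
  rewrite expsum_nil (_ : (fun s => _) = cst 0); first exact: is_derive_cst.
  by apply/funext => s; rewrite expsum_nil.
rewrite (_ : (fun s => _) = (fun s => complex.Re p.1 * cos (p.2 * s) -
  complex.Im p.1 * sin (p.2 * s) + complex.Re (expsum l s))); last first.
  by apply/funext => s; rewrite Re_expsum_cons.
have dM : is_derive t 1 (fun s => p.2 * s) p.2.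
  by apply: is_derive_eq; rewrite /GRing.scale/= mulr1.
have dcos := is_derive1_comp (is_derive_cos (p.2 * t)) dM.
have dsin := is_derive1_comp (is_derive_sin (p.2 * t)) dM.
apply: (is_derive_eq (is_deriveD (is_deriveB (is_deriveZ (complex.Re p.1) dcos)
  (is_deriveZ (complex.Im p.1) dsin)) IHl)).
rewrite /= Re_expsum_cons/=.
congr (_ + _); case: p {dM dcos dsin} => -[a b] c /=.
rewrite /GRing.scale/=; ring.
Qed.

Lemma continuous_Re_expsum l : continuous (fun s => complex.Re (expsum l s)).
Proof.
move=> t; apply/differentiable_continuous/derivable1_diffP.
exact: (@ex_derive _ _ _ _ _ _ _ (is_derive_Re_expsum l t)).
Qed.

(* By Rolle, a zero of f at t together with zeros of f accumulating at t would
   give zeros of f' accumulating at t. *)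
Lemma Re_expsum_near_neq0 m l t :
  complex.Re (expsum (iter m expsum_deriv l) t) != 0 ->
  \forall s \near t^', complex.Re (expsum l s) != 0.
Proof.
elim: m l => [|m IHm] l.
  move=> /= nz; apply: nbhs_dnbhs.
  by have /cvgr_neq0 := @continuous_Re_expsum l t; apply.
rewrite iterSr => /IHm dl.
have [l0|nz] := eqVneq (complex.Re (expsum l t)) 0; last first.
  by apply: nbhs_dnbhs; have /cvgr_neq0 := @continuous_Re_expsum l t; apply.
(* The radius on which the derivative has no zero apart from [t] serves for the function as well. *)
have [e /= e0 te] := dl; exists e => //= s tes st.
have critical a b : a < b -> complex.Re (expsum l a) = 0 ->
    complex.Re (expsum l b) = 0 ->
    exists2 c, a < c < b & complex.Re (expsum (expsum_deriv l) c) = 0.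
  move=> ab la lb.
  have [|||c cab dc] := @Rolle R (fun s => complex.Re (expsum l s)) a b ab.
  - by move=> x _; exact: (@ex_derive _ _ _ _ _ _ _ (is_derive_Re_expsum l x)).
  - exact/continuous_subspaceT/continuous_Re_expsum.
  - by rewrite la lb.
  exists c; first by move: cab; rewrite in_itv.
  rewrite -(@derive_val _ _ _ _ _ _ _ (is_derive_Re_expsum l c)).
  exact: (@derive_val _ _ _ _ _ _ _ dc).
apply/negP => /eqP ls; move: tes; rewrite /ball_/= => tes.
(* Strictly between [s] and [t] lies a zero of the derivative, closer to [t] than [s] is and
   distinct from [t]. *)
have [c ct] : exists2 c, (`|t - c| < e /\ c != t) &
    complex.Re (expsum (expsum_deriv l) c) = 0.
  have [lt_st|lt_ts|eq_st] := ltgtP s t; last by rewrite eq_st eqxx in st.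
    have [c /andP[sc ct] dc] := critical _ _ lt_st ls l0.
    exists c => //; split; last by rewrite lt_eqF.
    by move: tes; rewrite !ltr_norml => /andP[]; lra.
  have [c /andP[tc cs] dc] := critical _ _ lt_ts l0 ls.
  exists c => //; split; last by rewrite gt_eqF.
  by move: tes; rewrite !ltr_norml => /andP[]; lra.
by move=> /eqP; apply/negP; case: ct => ct ct'; exact: te.
Qed.

Definition expsum_scale (c : R[i]) l : seq (R[i] * R) :=
  [seq (c * p.1, p.2) | p <- l].

Lemma expsum_scaleE c l s : expsum (expsum_scale c l) s = c * expsum l s.
Proof.
elim: l => [|p l IHl]; first by rewrite !expsum_nil mulr0.
by rewrite [expsum_scale _ _]/= !expsum_cons IHl mulrDr mulrA.
Qed.

Lemma iter_expsum_deriv_scale m c l :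
  iter m expsum_deriv (expsum_scale c l) = expsum_scale c (iter m expsum_deriv l).
Proof.
elim: m => //= m ->; rewrite /expsum_deriv /expsum_scale -!map_comp.
by apply: eq_map => p /=; rewrite -mulrA.
Qed.

Lemma iter_expsum_deriv_cons m p l : iter m expsum_deriv (p :: l) =
  (p.1 * ('i * p.2%:C) ^+ m, p.2) :: iter m expsum_deriv l.
Proof.
elim: m => [|m IHm]; first by rewrite expr0 mulr1; case: p.
by rewrite !iterS IHm /= exprSr -mulrA.
Qed.

Lemma iter_expsum_deriv_nil m : iter m expsum_deriv [::] = [::].
Proof. by elim: m => //= m ->. Qed.

(** Up to its coefficient each term factors as [cis (p.2 * t) * cis (p.2 * h)], and the second
    factor is an everywhere convergent exponential series. *)
Lemma cvg_taylor_expsum l (t h : R) :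
  series (fun n => h%:C ^+ n / n`!%:R * expsum (iter n expsum_deriv l) t) @ \oo
    --> expsum l (t + h).
Proof.
elim: l => [|p l IHl].
  rewrite expsum_nil (_ : series _ = cst (0 : cnum R)).
    exact: (@cvg_cst (cnum R)).
  apply/funext => n; rewrite /series/= big1// => k _.
  by rewrite iter_expsum_deriv_nil expsum_nil mulr0.
have cP := @cvgMl_tmp (cnum R) _ _ _ _ (p.1 * cis (p.2 * t)) _
  (@cvg_series_cis R (p.2 * h)).
have {cP}cD := @cvgD _ (cnum R) _ _ _ _ _ _ _ (cP _) IHl.
rewrite expsum_cons mulrDr cisD mulrA (_ : series _ = fun n =>
    (p.1 * cis (p.2 * t)) *
    series (fun k => ('i * (p.2 * h)%:C) ^+ k / k`!%:R) n +
    series (fun k => h%:C ^+ k / k`!%:R * expsum (iter k expsum_deriv l) t) n).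
  exact: cD.
apply/funext => n; rewrite /series/= mulr_sumr -big_split/=.
apply: eq_bigr => k _; rewrite iter_expsum_deriv_cons expsum_cons mulrDr/=.
by congr (_ + _); rewrite !(exprMn, rmorphM)/= ?exprMn; ring.
Qed.

(** If all derivatives vanish at one point, the Taylor series there gives zero everywhere. Otherwise
    at every point some derivative is nonzero, which isolates the zeros. *)
Lemma expsum_dichotomy l : (forall s, expsum l s = 0) \/
  (forall t, \forall s \near t^', expsum l s != 0).
Proof.
have [[t lt]|nl] :=
    pselect (exists t, forall m, expsum (iter m expsum_deriv l) t = 0).
  left=> s; have := @cvg_taylor_expsum l t (s - t); rewrite subrKC.
  rewrite (_ : series _ = cst (0 : cnum R)).
    move=> /(@cvg_lim (cnum R) (@norm_hausdorff _ (cnum R))) <-.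
    exact: (@lim_cst (cnum R) (@norm_hausdorff _ (cnum R))).
  by apply/funext => n; rewrite /series/= big1// => k _; rewrite lt mulr0.
right=> t; have [m lm] : exists m, expsum (iter m expsum_deriv l) t != 0.
  apply: contrapT => lt; apply: nl; exists t => m.
  by apply: contrapT => /eqP lm; apply: lt; exists m.
(* Multiplication by [1] or by ['i] gives the nonzero value a nonzero real part. *)
have [c lc] : exists c, complex.Re (c * expsum (iter m expsum_deriv l) t) != 0.
  move: lm; case: (expsum _ _) => a b; rewrite eq_complex negb_and/=.
  have [->/= b0|a0 _] := eqVneq a 0; last by exists 1; rewrite mul1r.
  by exists 'i; rewrite /= mul0r mul1r sub0r oppr_eq0.
rewrite -expsum_scaleE -iter_expsum_deriv_scale in lc.
apply: filterS (Re_expsum_near_neq0 lc) => s.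
by apply: contra_neq; rewrite expsum_scaleE => ->; rewrite mulr0.
Qed.

End ExponentialSums.

(** * The ring of exponential sums, and formulas evaluated along a curve *)

Section ExponentialSumFunctions.
Variable R : realType.

Definition is_expsum (f : R -> R[i]) : Prop :=
  exists l, forall s, f s = expsum l s.

Lemma is_expsum_const c : is_expsum (fun=> c).
Proof.
exists [:: (c, 0)] => s.
by rewrite expsum_cons expsum_nil addr0/= mul0r cis0 mulr1.
Qed.

Lemma is_expsum_cis (a : R) : is_expsum (fun s => cis (s * a)).
Proof.
exists [:: (1, a)] => s.
by rewrite expsum_cons expsum_nil addr0/= mul1r mulrC.
Qed.

Lemma is_expsumD f g :
  is_expsum f -> is_expsum g -> is_expsum (fun s => f s + g s).
Proof.
move=> [l fl] [k gk]; exists (l ++ k) => s.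
by rewrite /expsum big_cat/= fl gk.
Qed.

Lemma is_expsumM f g :
  is_expsum f -> is_expsum g -> is_expsum (fun s => f s * g s).
Proof.
move=> [l fl] [k gk].
exists [seq (p.1 * q.1, p.2 + q.2) | p <- l, q <- k] => s.
rewrite fl gk /expsum big_allpairs_dep/= mulr_suml; apply: eq_bigr => p _.
rewrite mulr_sumr; apply: eq_bigr => q _ /=.
by rewrite mulrDl cisD; ring.
Qed.

Lemma is_expsumN f : is_expsum f -> is_expsum (fun s => - f s).
Proof.
move=> [l fl]; exists (expsum_scale (-1) l) => s.
by rewrite expsum_scaleE mulN1r fl.
Qed.

Lemma is_expsum_sum (I : finType) (f : I -> R -> R[i]) :
  (forall i, is_expsum (f i)) -> is_expsum (fun s => \sum_i f i s).
Proof.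
move=> ef; elim: (index_enum I) => [|i r IHr].
  by exists [::] => s; rewrite big_nil expsum_nil.
by have [l fl] := is_expsumD (ef i) IHr; exists l => s; rewrite big_cons fl.
Qed.

Lemma eq_is_expsum f g : f =1 g -> is_expsum f -> is_expsum g.
Proof. by move=> fg [l fl]; exists l => s; rewrite -fg. Qed.

Lemma is_expsum_continuous f : is_expsum f -> continuous (f : R -> cnum R).
Proof.
move=> [l /funext ->]; elim: l => [|p l IHl] t.
  rewrite (_ : expsum [::] = cst 0); first exact: (@cvg_cst (cnum R)).
  by apply/funext => s; rewrite expsum_nil.
rewrite (_ : expsum (p :: l) = fun s => p.1 * cis (p.2 * s) + expsum l s).
  apply: (@cvgD _ (cnum R)); last exact: IHl.
  apply: (@cvgMl_tmp (cnum R)); apply: continuous_comp; last first.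
    exact: continuous_cis.
  exact: mulrl_continuous.
by apply/funext => s; rewrite expsum_cons.
Qed.

Variable e : R -> seq R[i].
Hypothesis expsum_e : forall k, is_expsum (fun s => (e s)`_k).

Lemma is_expsum_eval t : GRing.rterm t ->
  is_expsum (fun s => GRing.eval (e s) t).
Proof.
elim: t => //=.
- by move=> c _; exact: is_expsum_const.
- by move=> n _; exact: is_expsum_const.
- by move=> t IHt u IHu /andP[/IHt et /IHu eu]; exact: is_expsumD.
- by move=> t IHt /IHt; exact: is_expsumN.
- move=> t IHt n /IHt /(is_expsumM (is_expsum_const n%:R)).
  by apply: eq_is_expsum => s; rewrite mulr_natl.
- by move=> t IHt u IHu /andP[/IHt et /IHu eu]; exact: is_expsumM.
- move=> t IHt n /IHt et; elim: n => [|n IHn].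
    by apply: eq_is_expsum (is_expsum_const 1) => s; rewrite expr0.
  by apply: eq_is_expsum (is_expsumM et IHn) => s; rewrite exprS.
Qed.

(** An atomic formula compares two exponential sums, so by the dichotomy it is true everywhere, or
    false on a punctured neighbourhood of every point. The value [b] is chosen before [t], which
    later links small [s] with [s] near 1. *)
Lemma qf_eval_near_const g : GRing.qf_form g && GRing.rformula g ->
  exists b, forall t, \forall s \near t^', GRing.qf_eval (e s) g = b.
Proof.
have near2 (op : bool -> bool -> bool) f h :
    (exists b, forall t, \forall s \near t^', GRing.qf_eval (e s) f = b) ->
    (exists b, forall t, \forall s \near t^', GRing.qf_eval (e s) h = b) ->
    exists b, forall t, \forall s \near t^',
      op (GRing.qf_eval (e s) f) (GRing.qf_eval (e s) h) = b.
  move=> [b fb] [c hc]; exists (op b c) => t.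
  by apply: filterS2 (fb t) (hc t) => s -> ->.
elim: g => //=.
- by move=> b _; exists b => t; exact: nearW.
- move=> t u /andP[/is_expsum_eval et /is_expsum_eval eu].
  have [l tul] := is_expsumD et (is_expsumN eu).
  have tuE s : (GRing.eval (e s) t == GRing.eval (e s) u) = (expsum l s == 0).
    by rewrite -subr_eq0 tul.
  have [l0|l0] := expsum_dichotomy l.
    by exists true => x; apply: nearW => s; rewrite tuE l0 eqxx.
  by exists false => x; apply: filterS (l0 x) => s /negPf; rewrite tuE.
- move=> f IHf h IHh /andP[/andP[? ?] /andP[? ?]].
  by apply: (near2 andb); [apply: IHf|apply: IHh]; apply/andP.
- move=> f IHf h IHh /andP[/andP[? ?] /andP[? ?]].
  by apply: (near2 orb); [apply: IHf|apply: IHh]; apply/andP.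
- move=> f IHf h IHh /andP[/andP[? ?] /andP[? ?]].
  by apply: (near2 implb); [apply: IHf|apply: IHh]; apply/andP.
- move=> f IHf /IHf[b fb]; exists (~~ b) => t.
  by apply: filterS (fb t) => s ->.
Qed.

End ExponentialSumFunctions.

(** * Exponentials of Hermitian matrices and powers of unitary ones *)

Section MatrixExponential.
Local Open Scope sesquilinear_scope.

Lemma cvg_mx_coord (K : numFieldType) m n (f : nat -> 'M[K]_(m, n))
    (M : 'M[K]_(m, n)) :
  (forall i j, (fun k => f k i j) @ \oo --> M i j) -> f @ \oo --> M.
Proof.
move=> fM A [P MP PA].
have : \forall k \near \oo, forall ij : 'I_m * 'I_n, P ij.1 ij.2 (f k ij.1 ij.2).
  by apply: filter_forall => -[i j] /=; exact/fM/MP.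
by apply: filterS => k fP; apply: PA => i j; exact: (fP (i, j)).
Qed.

Lemma mul_diag_mxE (F : fieldType) n (A B : 'M[F]_n) (d : 'rV[F]_n) i j :
  (A *m diag_mx d *m B) i j = \sum_k A i k * d 0 k * B k j.
Proof. by rewrite mul_mx_diag mxE; apply: eq_bigr => k _; rewrite mxE. Qed.

Lemma scale_mul_diag_mx (F : fieldType) n (A B : 'M[F]_n) (d : 'rV[F]_n) c :
  c *: (A *m diag_mx d *m B) = A *m diag_mx (c *: d) *m B.
Proof. by rewrite scalemxAl scalemxAr -linearZ. Qed.

Lemma sum_mul_diag_mx (F : fieldType) n (A B : 'M[F]_n) (I : Type) (r : seq I)
    (d : I -> 'rV[F]_n) :
  \sum_(i <- r) A *m diag_mx (d i) *m B = A *m diag_mx (\sum_(i <- r) d i) *m B.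
Proof. by rewrite -mulmx_suml -mulmx_sumr -linear_sum. Qed.

Lemma conj_diag_unitary (C : numClosedFieldType) n (P : 'M[C]_n)
    (d : 'rV[C]_n) :
  P \is unitarymx -> (forall j, d 0 j * (d 0 j)^* = 1)%R ->
  P^t* *m diag_mx d *m P \is unitarymx.
Proof.
move=> uP d1; rewrite !mul_unitarymx ?trmxC_unitary//.
apply/unitarymxP/matrixP => i j.
rewrite tr_diag_mx map_diag_mx mulmx_diag !mxE.
case: eqP => // ->; rewrite d1 ?mulr1n//.
Qed.

Lemma conj_diag_expr (F : fieldType) n (P : 'M[F]_n) (d : 'rV[F]_n) k :
  P \in unitmx ->
  (invmx P *m diag_mx d *m P) ^+ k =
  invmx P *m diag_mx (\row_j d 0 j ^+ k) *m P.
Proof.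
move=> uP; elim: k => [|k IHk].
  rewrite expr0 (_ : \row_j _ = const_mx 1); last first.
    by apply/rowP => j; rewrite !mxE.
  by rewrite diag_const_mx mulmx1 mulVmx.
rewrite exprSr IHk -[_ * _]/(_ *m _) !mulmxA mulmxK//.
rewrite -(mulmxA (invmx P)) mulmx_diag; congr (_ *m diag_mx _ *m _).
by apply/rowP => j; rewrite !mxE exprSr.
Qed.

(** By the spectral theorem [H] is unitarily diagonalizable with real eigenvalues, and the
    exponential is taken on the diagonal. [P] and [a] are the same for all [s], so the entries are
    exponential sums in [s]. *)
Lemma expmx_hermitian (R : realType) n (H : 'M[R[i]]_n) :
  H \is hermsymmx ->
  exists2 P : 'M[R[i]]_n, P \is unitarymx &
  exists a : 'I_n -> R, forall s : R, expmx (('i * s%:C) *: H) =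
    P^t* *m diag_mx (\row_j (cis (s * a j) : R[i])) *m P.
Proof.
move=> hH; have /hermitian_normalmx /orthomx_spectralP HE := hH.
have /mxOverP rD := hermitian_spectral_diag_real hH.
set P := spectralmx H in HE; have uP : P \is unitarymx := spectral_unitarymx H.
have PV := unitarymx_unit uP.
(* The eigenvalues are real, so taking real parts loses nothing. *)
exists P => //; exists (fun j => complex.Re (spectral_diag H 0 j)) => s.
set D := diag_mx (\row_j cis _).
rewrite -invmx_unitary//; apply: (@cvg_lim _ (@norm_hausdorff _ _)).
pose b j : R := complex.Re (spectral_diag H 0 j).
have bE : 'i * s%:C *: H =
    invmx P *m diag_mx (\row_j ('i * (s * b j)%:C)) *m P.
  rewrite {1}HE scale_mul_diag_mx.
  apply: (congr1 (fun c => invmx P *m diag_mx c *m P)).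
  apply/rowP => j; rewrite !mxE -[in LHS](RRe_real (rD 0 j)) -mulrA.
  by rewrite -rmorphM.
(* Conjugation by [P] commutes with powers and sums, leaving on the diagonal the partial sums of
   scalar exponential series. *)
have seriesE N : series (fun k => (k`!%:R)^-1 *: ('i * s%:C *: H) ^+ k) N =
    invmx P *m diag_mx (\row_j
      series (fun k => ('i * (s * b j)%:C) ^+ k / k`!%:R) N) *m P.
  rewrite /series/=.
  under eq_bigr do rewrite bE conj_diag_expr// scale_mul_diag_mx.
  rewrite sum_mul_diag_mx.
  apply: (congr1 (fun c => invmx P *m diag_mx c *m P)).
  apply/rowP => j; rewrite mxE summxE; apply: eq_bigr => k _.
  by rewrite !mxE mulrC.
apply: cvg_mx_coord => i j.
rewrite mul_diag_mxE (_ : (fun k => _) = fun N => \sum_k invmx P i k *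
    series (fun l => ('i * (s * b k)%:C) ^+ l / l`!%:R) N * P k j).
  apply: (@cvg_big (cnum R) _ +%R 0 _ (@add_continuous (cnum R))) => k _.
  rewrite mxE.
  apply: (@cvgMr_tmp (cnum R)); apply: (@cvgMl_tmp (cnum R)).
  exact: cvg_series_cis.
apply/funext => N; rewrite seriesE mul_diag_mxE.
by apply: eq_bigr => k _; rewrite mxE.
Qed.

End MatrixExponential.

Section UnitaryPowers.
Local Open Scope sesquilinear_scope.
Variables (R : realType) (n : nat) (logU : 'M[R[i]]_n -> 'M[R[i]]_n).
Hypothesis hlog : hermitian_log logU.
Variable U : 'M[R[i]]_n.
Hypothesis hU : U \is unitarymx.

Lemma unitary_power_unitary s : unitary_power logU U s \is unitarymx.
Proof.
have [/expmx_hermitian[P uP [a aE]] _] := hlog hU.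
rewrite /unitary_power aE; apply: conj_diag_unitary => // j.
by rewrite mxE; exact: cisMconj.
Qed.

Lemma unitary_power1 : unitary_power logU U 1 = U.
Proof. by rewrite /unitary_power mulr1; have [_ <-] := hlog hU. Qed.

Lemma is_expsum_unitary_power i j :
  is_expsum (fun s => unitary_power logU U s i j).
Proof.
have [/expmx_hermitian[P uP [a aE]] _] := hlog hU.
apply: eq_is_expsum (is_expsum_sum (fun k => is_expsumM (is_expsumM
  (is_expsum_const (P^t* i k)) (is_expsum_cis (a k))) (is_expsum_const (P k j)))).
move=> s; rewrite /unitary_power aE mul_diag_mxE.
by apply: eq_bigr => k _; rewrite [X in _ = _ * X * _]mxE.
Qed.

End UnitaryPowers.

(** * Continuity and compactness: limits of bounded solutions *)

Lemma continuous_eval (K : numFieldType) (T : topologicalType)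
    (co : T -> seq K) (x : T) (t : GRing.term K) :
  (forall k, {for x, continuous (fun z => (co z)`_k)}) ->
  GRing.rterm t -> {for x, continuous (fun z => GRing.eval (co z) t)}.
Proof.
move=> cco; elim: t => //=.
- by move=> c _; exact: cvg_cst.
- by move=> n _; exact: cvg_cst.
- by move=> t IHt u IHu /andP[/IHt ct /IHu cu]; exact: cvgD.
- by move=> t IHt /IHt; exact: cvgN.
- move=> t IHt n /IHt ct.
  rewrite (_ : (fun z => _) = fun z => n%:R * GRing.eval (co z) t).
    by apply: cvgM; [exact: cvg_cst|exact: ct].
  by apply/funext => z; rewrite mulr_natl.
- by move=> t IHt u IHu /andP[/IHt ct /IHu cu]; exact: cvgM.
- move=> t IHt n /IHt ct; elim: n => [|n IHn].
    rewrite (_ : (fun z => _) = cst 1); first exact: cvg_cst.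
    by apply/funext => z; rewrite expr0.
  rewrite (_ : (fun z => _) =
      fun z => GRing.eval (co z) t * GRing.eval (co z) t ^+ n).
    by apply: cvgM; [exact: ct|exact: IHn].
  by apply/funext => z; rewrite exprS.
Qed.

Lemma normc_Re_Im_le1 (R : rcfType) (z : R[i]) :
  `|z| <= 1 -> `|complex.Re z| <= 1 /\ `|complex.Im z| <= 1.
Proof.
have le1 (a b : R) : Num.sqrt (a ^+ 2 + b ^+ 2) <= 1 -> `|a| <= 1.
  by apply: le_trans; rewrite -sqrtr_sqr ler_wsqrtr// lerDl sqr_ge0.
rewrite normc_def lecE/= => /andP[_ z1]; split; first exact: le1 z1.
by rewrite addrC in z1; exact: le1 z1.
Qed.

Section BoundedSolutions.
Variables (R : realType) (m n : nat) (I : Type).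
Variable f : I -> 'rV[R[i]]_m * 'rV[R[i]]_n -> R[i].
Hypothesis polyf : forall i, polyfun (@pair_seq _ m n) (f i).
Variable p : R -> 'rV[R[i]]_m.
Hypothesis contp : forall i, continuous (fun s => p s 0 i : cnum R).

(** Compactness is used for real row vectors, so [n] complex coordinates are coded by [n + n] real
    ones, the real parts in the left half. *)
Let complex_row (v : 'rV[R]_(n + n)) : 'rV[R[i]]_n :=
  \row_j ((v 0 (lshift n j))%:C + 'i * (v 0 (rshift n j))%:C).

Let continuous_complex_row j :
  continuous (fun v : 'rV[R]_(n + n) => complex_row v 0 j : cnum R).
Proof.
move=> v; rewrite (_ : (fun v => _) = fun v : 'rV[R]_(n + n) =>
  ((v 0 (lshift n j))%:C : cnum R) + 'i * (v 0 (rshift n j))%:C);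
  last by apply/funext => w; rewrite mxE.
have cc k : {for v, continuous (fun w : 'rV[R]_(n + n) => (w 0 k)%:C : cnum R)}.
  apply: (@continuous_comp 'rV[R]_(n + n) R (cnum R) (fun w => w 0 k)
    (real_complex R : R -> cnum R)); first exact: coord_continuous.
  exact: continuous_real_complex.
have ic := @cvgMl_tmp (cnum R) _ _ _ _ ('i) _ (cc (rshift n j)).
exact: (@cvgD _ (cnum R) _ _ _ _ _ _ _ (cc (lshift n j)) (ic _)).
Qed.

Let continuous_f i (v : 'rV[R]_(n + n)) (t : R) :
  {for (v, t), continuous (fun z : 'rV[R]_(n + n) * R =>
     f i (p z.2, complex_row z.1) : cnum R)}.
Proof.
have [u ru fu] := polyf i.
rewrite (_ : (fun z => _) = fun z : 'rV[R]_(n + n) * R => GRing.eval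
  (pair_seq (p z.2, complex_row z.1)) u); last by apply/funext => z; exact: fu.
apply: (@continuous_eval (cnum R)) => // k.
have [km|mk] := ltnP k m.
  rewrite (_ : (fun z => _) = fun z : 'rV[R]_(n + n) * R =>
      p z.2 0 (Ordinal km) : cnum R).
    apply: (@continuous_comp _ _ _ snd (fun s => p s 0 (Ordinal km) : cnum R)).
      exact: cvg_snd.
    exact: contp.
  apply/funext => z; rewrite nth_cat size_row_seq km.
  exact: (nth_row_seq _ (Ordinal km)).
have [kn|nk] := ltnP (k - m) n.
  rewrite (_ : (fun z => _) = fun z : 'rV[R]_(n + n) * R =>
      complex_row z.1 0 (Ordinal kn) : cnum R).
    apply: (@continuous_comp _ _ _ fst
      (fun v => complex_row v 0 (Ordinal kn) : cnum R)).
      exact: cvg_fst.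
    exact: continuous_complex_row.
  apply/funext => z; rewrite nth_cat size_row_seq ltnNge mk/=.
  exact: (nth_row_seq _ (Ordinal kn)).
rewrite (_ : (fun z => _) = cst (0 : cnum R)).
  exact: (@cvg_cst (cnum R)).
apply/funext => z; rewrite nth_cat size_row_seq ltnNge mk/=.
by rewrite nth_default// size_row_seq.
Qed.

(** Without a solution at [t], each point of a compact cube has a neighbourhood on which some
    equation fails for all [s] near [t]. Compactness makes the range of [s] uniform, which
    contradicts the bounded solutions. *)
Lemma bounded_zero_limit (t : R) :
  (\forall s \near t^', exists y : 'rV_n,
     (forall j, `|y 0 j| <= 1) /\ forall i, f i (p s, y) = 0) ->
  exists y, forall i, f i (p t, y) = 0.
Proof.
move=> near_sol; apply: contrapT => nosol.
(* This cube contains the codes of all [y] whose entries have modulus at most 1. *)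
pose K := [set v : 'rV[R]_(n + n) | forall j, `[-1, 1]%classic (v ord0 j)].
have /compact_near_coveringP cK : compact K.
  apply: (@rV_compact R _ (fun=> `[-1, 1]%classic)) => _.
  exact: segment_compact.
have /cK noK : forall v, K v -> \forall v' \near v & s \near t^',
    exists i, f i (p s, complex_row v') != 0.
  move=> v Kv; have [i fi] : exists i, f i (p t, complex_row v) != 0.
    apply: contrapT => fv; apply: nosol; exists (complex_row v) => i.
    by apply: contrapT => /eqP fi; apply: fv; exists i.
  have /cvgr_neq0 /(_ fi) := @continuous_f i v t.
  move=> -[[A B] /= [vA tB] AB]; exists (A, B) => /=.
    by split=> //; exact: nbhs_dnbhs.
  by move=> z zAB; exists i; exact: AB.
(* The filter of punctured neighbourhoods is proper, so some [s] meets both conditions. *)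
have [s [[y [y1 fy]] Ks]] :=
  @filter_ex _ (t^') _ _ (@filterI _ (t^') _ _ _ near_sol noK).
pose v : 'rV[R]_(n + n) :=
  row_mx (\row_j complex.Re (y 0 j)) (\row_j complex.Im (y 0 j)).
have [|i] := Ks v.
  move=> k; rewrite /= in_itv/= -ler_norml.
  by case: (split_ordP k) => j ->; rewrite ?row_mxEl ?row_mxEr mxE;
    have [] := normc_Re_Im_le1 (y1 j).
rewrite (_ : complex_row v = y) ?fy ?eqxx//.
apply/rowP => j; rewrite mxE row_mxEl row_mxEr !mxE.
by rewrite -complexE.
Qed.

End BoundedSolutions.

(** * Idempotents and orthogonal projections *)

Section IdempotentFlags.
Local Open Scope sesquilinear_scope.

(** In a full-rank factorization [P = C R], idempotence forces [R C = 1], and [C R] has the same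
    trace as [R C]. *)
Lemma idempotent_mxtrace (F : fieldType) n (P : 'M[F]_n) :
  P *m P = P -> \tr P = (\rank P)%:R.
Proof.
rewrite -{1 2 3 4}(mulmx_base P) mulmxA -(mulmxA (col_base P)) => PP.
have RC : row_base P *m col_base P = 1%:M.
  apply: (row_full_inj (col_base_full P)).
  by apply: (row_free_inj (row_base_free P)); rewrite mulmx1.
by rewrite mxtrace_mulC RC mxtrace1.
Qed.

Variables (C : numClosedFieldType) (n d : nat) (B : 'I_d -> 'M[C]_n).

(* Acting on row vectors, [P] projects onto a subspace V of dimension [k] and
   [Q] onto a subspace W of dimension [w], with V and all the B_j(V) inside W. *)
Definition flag_projections (k w : nat) (P Q : 'M[C]_n) : Prop :=
  [/\ P *m P = P, Q *m Q = Q, \tr P = k%:R & \tr Q = w%:R] /\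
  P *m Q = P /\ forall j, P *m (B j)^T *m Q = P *m (B j)^T.

(** A diagonal entry of [P] equals the sum of the squared moduli of its row, hence is at least its
    own square. So it is at most 1, and it bounds the squared modulus of every entry in the row. *)
Lemma orthogonal_projection_entry_le1 (P : 'M[C]_n) i j :
  P^t* = P -> P *m P = P -> `|P i j| <= 1.
Proof.
move=> hP PP.
have PiE : P i i = \sum_k `|P i k| ^+ 2.
  rewrite -{1}PP mxE; apply: eq_bigr => k _.
  by rewrite normCK; congr (_ * _); rewrite -[in LHS]hP !mxE.
have Pii0 : 0 <= P i i by rewrite PiE sumr_ge0// => k _; exact: exprn_ge0.
have lePii k : `|P i k| ^+ 2 <= P i i.
  rewrite PiE (bigD1 k)//= lerDl sumr_ge0// => l _; exact: exprn_ge0.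
have Pii1 : P i i <= 1.
  move: Pii0; rewrite le_eqVlt => /predU1P[<-|Pii0]; first exact: ler01.
  by have := lePii i; rewrite gtr0_norm// expr2 -{3}[P i i]mulr1 ler_pM2l.
by rewrite -(@expr_le1 _ 2)//; exact: le_trans (lePii j) Pii1.
Qed.

(** Gram-Schmidt gives a matrix with orthonormal rows and the same row space; its conjugate
    transpose times itself is the orthogonal projection onto that space. *)
Lemma flag_projections_bounded k w (X : 'M[C]_(k, n)) (Y : 'M[C]_(w, n)) :
  row_free X -> row_free Y -> (X <= Y)%MS ->
  (forall j, (X *m (B j)^T <= Y)%MS) ->
  exists P Q, flag_projections k w P Q /\
    forall i j, `|P i j| <= 1 /\ `|Q i j| <= 1.
Proof.
move=> fX fY XY BXY.
pose proj m (Z : 'M[C]_(m, n)) := (schmidt Z)^t* *m schmidt Z.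
have uni m (Z : 'M[C]_(m, n)) : row_free Z ->
    schmidt Z *m (schmidt Z)^t* = 1%:M.
  move=> fZ; apply/unitarymxP/schmidt_unitarymx.
  by rewrite -(eqP fZ) rank_leq_col.
have projK m (Z : 'M[C]_(m, n)) : row_free Z -> proj _ Z *m proj _ Z = proj _ Z.
  by move=> fZ; rewrite /proj mulmxA -(mulmxA _ (schmidt Z)) uni// mulmx1.
have projtr m (Z : 'M[C]_(m, n)) : row_free Z -> \tr (proj _ Z) = m%:R.
  by move=> fZ; rewrite /proj mxtrace_mulC uni// mxtrace1.
have projid m l (Z : 'M[C]_(m, n)) (M : 'M[C]_(l, n)) : row_free Z ->
    (M <= Z)%MS -> M *m proj _ Z = M.
  move=> fZ; rewrite -(eqmx_schmidt_free fZ) => /submxP[D ->].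
  by rewrite /proj mulmxA -(mulmxA D) uni// mulmx1.
have projherm m (Z : 'M[C]_(m, n)) : (proj _ Z)^t* = proj _ Z.
  by rewrite /proj trmx_mul map_mxM trmxCK.
have projX : (proj _ X <= X)%MS.
  by rewrite (submx_trans (submxMl _ _))// eqmx_schmidt_free.
exists (proj _ X), (proj _ Y); split; last first.
  by move=> i j; split; apply: orthogonal_projection_entry_le1; rewrite ?projK.
split; first by split; rewrite ?projK ?projtr.
split=> [|j]; first by rewrite projid// (submx_trans projX).
by rewrite projid// (submx_trans _ (BXY j))// submxMr.
Qed.

Lemma flag_projections_rank k w P Q : flag_projections k w P Q ->
  \rank P = k /\ \rank Q = w.
Proof.
move=> [[PP QQ trP trQ] _]; split; apply/eqP.
  by rewrite -(eqr_nat C) -idempotent_mxtrace// trP.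
by rewrite -(eqr_nat C) -idempotent_mxtrace// trQ.
Qed.

(** Orthogonality involves conjugation and is not a polynomial condition, so solving the equations
    only yields idempotents. Replacing them by orthogonal projections with the same row spaces
    restores boundedness. *)
Lemma flag_projections_normalize k w P Q : flag_projections k w P Q ->
  exists P' Q', flag_projections k w P' Q' /\
    forall i j, `|P' i j| <= 1 /\ `|Q' i j| <= 1.
Proof.
move=> fPQ; have [<- <-] := flag_projections_rank fPQ.
have [_ [PQ PBQ]] := fPQ.
apply: (@flag_projections_bounded _ _ (row_base P) (row_base Q)).
- exact: row_base_free.
- exact: row_base_free.
- by rewrite !eq_row_base -PQ submxMl.
- move=> j; rewrite eq_row_base.
  have PB : (row_base P *m (B j)^T <= P *m (B j)^T)%MS.
    by rewrite submxMr// eq_row_base.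
  by apply: submx_trans PB _; rewrite -PBQ submxMl.
Qed.

End IdempotentFlags.

(** * Passage between row spaces and subspaces of column vectors *)

Section RowSpan.
Variables (F : fieldType) (n : nat).

Definition row_span m (X : 'M[F]_(m, n)) : {vspace 'cV[F]_n} :=
  <<[tuple (row i X)^T | i < m]>>%VS.

Lemma mem_row_span m (X : 'M[F]_(m, n)) (v : 'cV[F]_n) :
  (v \in row_span X) = (v^T <= X)%MS.
Proof.
apply/idP/idP => [/coord_span -> | /submxP[D vE]].
  rewrite linear_sum/= summx_sub// => i _; rewrite linearZ/= scalemx_sub//.
  by rewrite nth_mktuple trmxK row_sub.
rewrite -(trmxK v) vE mulmx_sum_row linear_sum/= memv_suml// => i _.
rewrite linearZ/= memvZ// memv_span//.
by apply/mapP; exists i; rewrite ?mem_enum.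
Qed.

Lemma free_row_span m (X : 'M[F]_(m, n)) :
  row_free X = free [tuple (row i X)^T | i < m].
Proof.
have sumE (k : 'I_m -> F) : \sum_i k i *: [tuple (row i X)^T | i < m]`_i =
    ((\row_i k i) *m X)^T.
  rewrite mulmx_sum_row linear_sum/=; apply: eq_bigr => i _.
  by rewrite mxE linearZ/= nth_mktuple.
apply/idP/freeP => [fX k|fX].
  rewrite sumE => /eqP; rewrite trmx_eq0 => /eqP kX i.
  have /rowP/(_ i) : \row_i k i = 0.
    by apply: (row_free_inj fX); rewrite kX mul0mx.
  by rewrite !mxE.
apply: inj_row_free => v vX; apply/rowP => i; rewrite mxE.
apply: (fX (v 0)); rewrite sumE (_ : \row_i v 0 i = v) ?vX ?trmx0//.
by apply/rowP => j; rewrite mxE.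
Qed.

Lemma dim_row_span m (X : 'M[F]_(m, n)) : row_free X -> \dim (row_span X) = m.
Proof. by rewrite free_row_span /free => /eqP ->; rewrite size_tuple. Qed.

Lemma row_space_of_vspace (V : {vspace 'cV[F]_n}) :
  exists2 X : 'M[F]_(\dim V, n), row_free X & forall v, (v \in V) = (v^T <= X)%MS.
Proof.
pose X : 'M[F]_(\dim V, n) := \matrix_i (tnth (vbasis V) i)^T.
have XE : [tuple (row i X)^T | i < \dim V] = vbasis V.
  by apply: eq_from_tnth => i; rewrite tnth_mktuple rowK trmxK.
exists X; first by rewrite free_row_span XE (basis_free (vbasisP V)).
by move=> v; rewrite -mem_row_span /row_span XE (span_basis (vbasisP V)).
Qed.

End RowSpan.

Section FlagProjectionsSubspaces.
Variables (R : realType) (n d : nat) (B : 'I_d -> 'M[R[i]]_n).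
Implicit Type V : {vspace 'cV[R[i]]_n}.

Lemma flag_projections_of_subspace V :
  exists P Q, flag_projections B (\dim V) (\dim (V + tuple_image B V)) P Q.
Proof.
have [X fX VE] := row_space_of_vspace V.
have [Y fY WE] := row_space_of_vspace (V + tuple_image B V).
have XV i : (row i X)^T \in V by rewrite VE trmxK row_sub.
have [||P [Q [fPQ _]]] := flag_projections_bounded (B := B) fX fY; last 1 first.
- by exists P, Q.
- apply/row_subP => i; rewrite -[row i X]trmxK -WE.
  by rewrite (subvP (addvSl _ _)).
move=> j; apply/row_subP => i.
rewrite -[row i _]trmxK -WE row_mul trmx_mul trmxK.
rewrite (subvP (addvSr _ _))// /tuple_image.
apply: (subvP (sumv_sup j _ (subvv _))) => //.
by rewrite -[B j *m _](lfunE (mulmx (B j))) memv_img.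
Qed.

(** Only an inequality can be claimed, since the row space of [Q] may be larger than needed; it
    suffices to bound the expansion ratio of [V] from above. *)
Lemma subspace_of_flag_projections k w P Q : flag_projections B k w P Q ->
  exists2 V, \dim V = k & (\dim (V + tuple_image B V) <= w)%N.
Proof.
move=> fPQ; have [kE wE] := flag_projections_rank fPQ.
have [_ [PQ PBQ]] := fPQ.
exists (row_span (row_base P)); first by rewrite dim_row_span ?row_base_free.
rewrite -wE -(dim_row_span (row_base_free Q)); apply: dimvS.
rewrite subv_add; apply/andP; split.
  apply/subvP => v; rewrite !mem_row_span !eq_row_base => vP.
  by apply: submx_trans vP _; rewrite -PQ submxMl.
apply/subv_sumP => j _; apply/subvP => _ /memv_imgP[v vP ->].
move: vP; rewrite lfunE/= !mem_row_span !eq_row_base trmx_mul => vP.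
by apply: submx_trans (submxMr _ vP) _; rewrite -PBQ submxMl.
Qed.

End FlagProjectionsSubspaces.

(** * Flags as solutions of a polynomial system *)

Section FlagEquations.
Variables (F : fieldType) (n d k w : nat).

Let params := 'rV[F]_(d * (n * n)).
Let unknowns := 'rV[F]_(n * n + n * n).

Definition decode_tuple (x : params) (j : 'I_d) : 'M[F]_n :=
  vec_mx (row j (vec_mx x)).

Definition encode_tuple (B : 'I_d -> 'M[F]_n) : params :=
  mxvec (\matrix_j mxvec (B j)).

(** [true] selects the smaller projection [P], [false] the larger one [Q]. *)
Definition decode_pair (b : bool) (y : unknowns) : 'M[F]_n :=
  vec_mx (if b then lsubmx y else rsubmx y).

Definition encode_pair (P Q : 'M[F]_n) : unknowns := row_mx (mxvec P) (mxvec Q).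

Lemma encode_tupleK B : decode_tuple (encode_tuple B) =1 B.
Proof. by move=> j; rewrite /decode_tuple mxvecK rowK mxvecK. Qed.

Lemma encode_pairK P Q b :
  decode_pair b (encode_pair P Q) = if b then P else Q.
Proof. by case: b; rewrite /decode_pair ?row_mxKl ?row_mxKr mxvecK. Qed.

(** Every condition is a matrix equation, the trace ones through scalar matrices, so that the
    entries form a single finite family of polynomial equations. *)
Definition flag_equation (e : (bool * bool) + option 'I_d)
    (z : params * unknowns) : 'M[F]_n :=
  match e with
  | inl (true, b) => decode_pair b z.2 *m decode_pair b z.2 - decode_pair b z.2
  | inl (false, b) => (\tr (decode_pair b z.2) - (if b then k else w)%:R)%:M
  | inr None => decode_pair true z.2 *m decode_pair false z.2
                - decode_pair true z.2
  | inr (Some j) =>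
      decode_pair true z.2 *m (decode_tuple z.1 j)^T *m decode_pair false z.2
      - decode_pair true z.2 *m (decode_tuple z.1 j)^T
  end.

Lemma polymx_flag_equation e : polymx (@pair_seq F _ _) (flag_equation e).
Proof.
have pX b : polymx (@pair_seq F _ _)
    (fun z : params * unknowns => decode_pair b z.2).
  by case: b => i j; rewrite /decode_pair;
    under eq_fun do rewrite !mxE; exact: polyfun_snd.
have pB c : polymx (@pair_seq F _ _)
    (fun z : params * unknowns => decode_tuple z.1 c).
  by move=> i j; under eq_fun do rewrite !mxE; exact: polyfun_fst.
case: e => [[[] b]|[c|]] /=.
- exact: polymxB (polymxM (pX b) (pX b)) (pX b).
- move=> i j; under eq_fun do rewrite mxE.
  case: (i == j); last exact: polyfun_const.
  exact: polyfunD (polyfun_mxtrace (pX b)) (polyfun_const _ _).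
- have pXB := polymxM (pX true) (polymx_tr (pB c)).
  exact: polymxB (polymxM pXB (pX false)) pXB.
- exact: polymxB (polymxM (pX true) (pX false)) (pX true).
Qed.

End FlagEquations.

Lemma flag_equationP (C : numClosedFieldType) (n d k w : nat) x y :
  (forall e, @flag_equation C n.+1 d k w e (x, y) = 0) <->
  flag_projections (decode_tuple x) k w (decode_pair true y) (decode_pair false y).
Proof.
split=> [eq0|[[PP QQ trP trQ] [PQ PBQ]]].
  have idem b := subr0_eq (eq0 (inl (true, b))).
  have tr b : \tr (decode_pair b y) = (if b then k else w)%:R.
    (* The positive size [n.+1] provides an entry from which the scalar is read off. *)
    apply: subr0_eq; have /matrixP/(_ 0 0) := eq0 (inl (false, b)).
    by rewrite !mxE eqxx mulr1n.
  split; first by split; [exact: idem|exact: idem|exact: tr|exact: tr].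
  split; first exact: subr0_eq (eq0 (inr None)).
  by move=> j; exact: subr0_eq (eq0 (inr (Some j))).
case=> [[[] []]|[j|]] /=; apply/eqP.
- by rewrite subr_eq0 PP.
- by rewrite subr_eq0 QQ.
- by rewrite trP subrr raddf0.
- by rewrite trQ subrr raddf0.
- by rewrite subr_eq0 PBQ.
- by rewrite subr_eq0 PQ.
Qed.

Lemma flag_projections_ext (C : numClosedFieldType) (n d k w : nat)
    (A B : 'I_d -> 'M[C]_n) P Q :
  A =1 B -> flag_projections A k w P Q -> flag_projections B k w P Q.
Proof. by move=> AB [PQ [le PBQ]]; split=> //; split=> // j; rewrite -AB. Qed.

(** * Flags along a curve of exponential sums *)

Section FlagProjectionsAlongCurve.
Variables (R : realType) (n d : nat) (B : R -> 'I_d -> 'M[R[i]]_n.+1).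
Hypothesis expsum_B : forall j a b, is_expsum (fun s => B s j a b).

(** Existence of a flag has one truth value near all points, each point itself excluded. If it is
    true, bounded flags near [t1] yield one at [t1]; if it is false, there are none near [t0] and
    the implication is vacuous. *)
Lemma flag_projections_near_imp (k w : nat) (t0 t1 : R) :
  \forall s \near t0^',
    (exists P Q, flag_projections (B s) k w P Q) ->
    exists P Q, flag_projections (B t1) k w P Q.
Proof.
pose f (i : ((bool * bool) + option 'I_d) * ('I_n.+1 * 'I_n.+1)) z :=
  @flag_equation R[i] n.+1 d k w i.1 z i.2.1 i.2.2.
have polyf i : polyfun (@pair_seq _ _ _) (f i) by exact: polymx_flag_equation.
pose p s := encode_tuple (B s).
have fP s y : (forall i, f i (p s, y) = 0) <->
    flag_projections (B s) k w (decode_pair true y) (decode_pair false y).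
  have BE : decode_tuple (p s) =1 B s := encode_tupleK (B s).
  split=> [f0|/(flag_projections_ext (fsym BE))/flag_equationP e0 i].
    apply: flag_projections_ext BE _; apply/flag_equationP => e.
    by apply/matrixP => a b; rewrite [RHS]mxE; exact: (f0 (e, (a, b))).
  by rewrite /f e0 mxE.
have solP s : (exists P Q, flag_projections (B s) k w P Q) <->
    exists y, forall i, f i (p s, y) = 0.
  split=> [[P [Q fPQ]]|[y /fP fPQ]]; last by do 2!eexists; exact: fPQ.
  by exists (encode_pair P Q); apply/fP; rewrite !encode_pairK.
have expsum_p i : is_expsum (fun s => p s 0 i).
  case/mxvec_indexP: i => j i; under eq_fun do rewrite mxvecE mxE.
  by case/mxvec_indexP: i => a b; under eq_fun do rewrite mxvecE.
have [g qfg gP] := zero_locus_projection polyf.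
have [|[] gb] := @qf_eval_near_const R (fun s => row_seq (p s)) _ g qfg.
- move=> l; have [ln|nl] := ltnP l (d * (n.+1 * n.+1)).
    apply: eq_is_expsum (expsum_p (Ordinal ln)) => s.
    by rewrite -nth_row_seq.
  apply: eq_is_expsum (is_expsum_const 0) => s.
  by rewrite nth_default// size_row_seq.
- apply: nearW => s _; apply/solP/(bounded_zero_limit polyf).
    by move=> i; exact: is_expsum_continuous.
  apply: filterS (gb t1) => {}s /gP/solP[P [Q]].
  case/flag_projections_normalize => P' [Q' [fPQ le1]].
  exists (encode_pair P' Q'); split; last by apply/fP; rewrite !encode_pairK.
  move=> j; case: (split_ordP j) => {}j ->;
    case/mxvec_indexP: j => a b; rewrite ?row_mxEl ?row_mxEr mxvecE;
    by have [] := le1 a b.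
- by apply: filterS (gb t0) => s gF /solP/gP; rewrite gF.
Qed.

End FlagProjectionsAlongCurve.

(** * Comparison of the dimension expansions *)

Theorem theorem2p1 (R : realType) (n : nat) (hn : (2 <= n)%N)
    (logU : 'M[R[i]]_n -> 'M[R[i]]_n) (hlog : hermitian_log logU)
    (d : nat) (hd : (1 <= d)%N)
    (U : 'I_d -> 'M[R[i]]_n) (hU : forall j, U j \is unitarymx) :
  exists2 s0 : R, 0 < s0 &
    forall s : R, 0 < s < s0 ->
      (forall j, unitary_power logU (U j) s \is unitarymx) /\
      mu U / d%:R <= mu (fun j => unitary_power logU (U j) s).
Proof.
case: n hn logU hlog U hU => [//|n] hn logU hlog U hU.
pose B s j := unitary_power logU (U j) s.
(* The minimizing subspace varies with [s], but only finitely many pairs of dimensions occur, so one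
   punctured neighbourhood of 0 serves them all. *)
have : \forall s \near 0^', forall kw : 'I_n.+2 * 'I_n.+2,
    (exists P Q, flag_projections (B s) kw.1 kw.2 P Q) ->
    exists P Q, flag_projections (B 1) kw.1 kw.2 P Q.
  apply: filter_forall => -[k w] /=; apply: flag_projections_near_imp.
  by move=> j a b; exact: is_expsum_unitary_power.
move=> [e /= e0 flagB]; exists e => // s /andP[s0 se].
split=> [j|]; first exact: unitary_power_unitary.
have [V smallV ->] := @mu_attained R n.+1 d (B s) hn.
have dimn (W : {vspace 'cV[R[i]]_n.+1}) : (\dim W < n.+2)%N.
  by have := dimvS (subvf W); rewrite dimvf dim_matrix [X in (_ <= X)%N]muln1.
(* The flag of the minimizer [V] for [B s] is carried over to the parameter 1, where the tuple is
   [U]. *)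
have := flagB s _ _
  (Ordinal (dimn V), Ordinal (dimn (V + tuple_image (B s) V)%VS)).
rewrite /= sub0r normrN gtr0_norm// gt_eqF// => /(_ se isT).
move=> /(_ (flag_projections_of_subspace (B s) V))[P [Q]].
have BU : B 1 =1 U by move=> j; exact: unitary_power1.
move=> /(flag_projections_ext BU) /subspace_of_flag_projections[W dimW leW].
(* [W] has the same dimension as [V], so it competes in the minimum for [U]. *)
have smallW : small_subspace W by rewrite /small_subspace dimW.
have mu0 : 0 <= mu U.
  have [W' _ ->] := @mu_attained R n.+1 d U hn; exact: expansion_ratio_ge0.
(* As [mu U] is nonnegative and [d] is at least 1, it suffices to bound the ratio of [V] from below
   by [mu U]. *)
apply: (@le_trans _ _ (mu U)).
  by rewrite ler_pdivrMr ?ltr0n// ler_peMr// ler1n.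
apply: le_trans (mu_le U smallW) _.
rewrite /expansion_ratio dimW ler_wpM2r ?invr_ge0//.
by rewrite lerD2r ler_nat.
Qed.
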